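(* Let $k \geq 2$ be an integer. Then for every positive integer $n$, \[ \mathrm{ex}(n,\{C_4,C_6,\dots,C_{2k}\}) \;\leq\; \tfrac{1}{2}\,n^{1+\frac{1}{k}} + 2^{k^2} n. \] That is, every simple graph on $n$ vertices that contains no cycle of length $4,6,\dots,2k$ (as a subgraph) has at most $\tfrac{1}{2}n^{1+1/k} + 2^{k^2}n$ edges.
   Context: For a set $\mathcal{C}$ of cycles, $\mathrm{ex}(n,\mathcal{C})$ denotes the maximum number of edges in a simple graph on $n$ vertices containing none of the cycles in $\mathcal{C}$ as a subgraph; $C_\ell$ denotes the cycle of length $\ell$. *)

(* Defs.v *)
From mathcomp Require Import all_boot.

Set Implicit Arguments.
Unset Strict Implicit.
Unset Printing Implicit Defensive.

(* A graph on the vertex set T is represented by its edge set. *)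
Definition simple_graph (T : finType) (E : {set {set T}}) : bool :=
  [forall e in E, #|e| == 2].

Definition adjacent (T : finType) (E : {set {set T}}) : rel T :=
  [rel x y | [set x; y] \in E].

(* C_l is a (not necessarily induced) subgraph of E. Only meaningful for
   l >= 3: for l = 2 any edge satisfies the formula. *)
Definition contains_cycle (T : finType) (E : {set {set T}}) (l : nat) : bool :=
  [exists c : l.-tuple T, ucycleb (adjacent E) c].

(* ex(n, {C_l | l in L}) *)
Definition ex_cycles (n : nat) (L : seq nat) : nat :=
  \max_(E : {set {set 'I_n}} |
        simple_graph E && all (fun l => ~~ contains_cycle E l) L) #|E|.

Definition even_lengths (k : nat) : seq nat := [seq i.*2 | i <- iota 2 k.-1].

Lemma mem_even_lengths k l :
  (l \in even_lengths k) = ~~ odd l && (4 <= l <= k.*2).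
Proof.
case: k => [|k]; first by case: l => [|[|[|[|l]]]] //=; rewrite andbF.
apply/mapP/andP => [[i]|[el /andP[l4 lk]]].
  rewrite mem_iota add2n ltnS => i2k ->.
  by rewrite odd_double -[4]/(2.*2) !leq_double.
have lE : l = l./2.*2 by rewrite -[LHS]odd_double_half (negbTE el).
exists l./2 => //; rewrite mem_iota add2n ltnS.
by rewrite -leq_double -lE l4 -leq_double -lE.
Qed.

Lemma ex_cycles_leP n L m :
  reflect (forall E : {set {set 'I_n}}, simple_graph E ->
             (forall l, l \in L -> ~~ contains_cycle E l) -> #|E| <= m)
          (ex_cycles n L <= m).
Proof.
apply: (iffP (bigmax_leqP _ _ _)) => H E; last by case/andP=> sE /allP; exact: H.
by move=> sE fE; apply: H; rewrite sE; apply/allP.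
Qed.

(* Main.v *)
(** Let [r = n^(1/k)] and [C = 2^(k^2)].  A graph with more edges than claimed
    has an induced subgraph of average degree above [r + 2 C] and minimum degree
    at least [r/2 + C].  Without even cycles of length at most [2 k], for every
    [j < k] a vertex at distance [j] from [v] has at most one neighbour at
    distance [j - 1] and at most one at distance [j], so all its other
    neighbours are at distance [j + 1], and distinct vertices at distance [j]
    share none of these.  Hence [n >= deg v * (r/2)^(k-1)], which bounds all
    degrees by [D = 2^(k-1) r], and all but [2 (k-1) D^(k-1)] walks of length
    [k] from [v] are determined by their end.  But the total number of walks of
    length [k] is at least the number of vertices times the [k]-th power of the
    average degree, which is too much. *)

Require Import Defs.
From mathcomp Require Import all_boot all_order all_algebra.
From mathcomp Require Import zify ring lra.
From mathcomp Require Import reals exp.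

Set Implicit Arguments.
Unset Strict Implicit.
Unset Printing Implicit Defensive.

Import Order.TTheory GRing.Theory Num.Theory.

Local Open Scope ring_scope.

(** * Walks and distance layers *)

Section Layers.
Local Open Scope nat_scope.

Variables (T : finType) (e : rel T).
Hypothesis e_sym : symmetric e.

Definition degree (x : T) : nat := #|[set y | e x y]|.

Fixpoint walks (j : nat) (v x : T) : nat :=
  if j is j'.+1 then \sum_(y | e y x) walks j' v y else v == x.

Definition walks_from (j : nat) (v : T) : nat := \sum_x walks j v x.

(* The vertices at distance exactly j from v. *)
Definition layer (j : nat) (v : T) : {set T} :=
  [set x | (0 < walks j v x) && [forall i : 'I_j, walks i v x == 0]].

(** The bound [3 < size c] matters: two distinct adjacent vertices already form a [ucycle] of size
    2. *)
Definition even_cycle_free (k : nat) : Prop :=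
  forall c : seq T,
    ucycle e c -> ~~ odd (size c) -> 3 < size c <= k.*2 -> False.

Lemma layerP j v x :
  reflect (0 < walks j v x /\ forall i, 0 < walks i v x -> j <= i)
          (x \in layer j v).
Proof.
rewrite inE; apply: (iffP andP) => -[Wx Wmin]; split=> //.
  move=> i Wi; rewrite leqNgt; apply/negP => ltij.
  by have /forallP/(_ (Ordinal ltij))/eqP /= W0 := Wmin; rewrite W0 in Wi.
apply/forallP => i; rewrite eqn0Ngt; apply/negP => /Wmin.
by rewrite leqNgt ltn_ord.
Qed.

Definition neighbours (A : {set T}) (w : T) : {set T} := [set x in A | e w x].

Lemma in_neighbours A w x : (x \in neighbours A w) = (x \in A) && e w x.
Proof. by rewrite inE. Qed.

Lemma card_neighbours A w : #|neighbours A w| = \sum_(x in A) e w x.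
Proof.
rewrite -sum1_card big_mkcond [RHS]big_mkcond; apply: eq_bigr => x _.
by rewrite in_neighbours; case: (x \in A); case: (e w x).
Qed.

Lemma layer_uniq i j v x : x \in layer i v -> x \in layer j v -> i = j.
Proof.
move=> /layerP[Wi mini] /layerP[Wj minj].
by apply/eqP; rewrite eqn_leq mini // minj.
Qed.

Lemma mem_layer0 v x : (x \in layer 0 v) = (x == v).
Proof. by apply/layerP/eqP => [[]|->] /=; [case: eqP|rewrite eqxx]. Qed.

Lemma walksS_gt0 j v x y : e y x -> 0 < walks j v y -> 0 < walks j.+1 v x.
Proof. by move=> eyx Wy /=; rewrite (bigD1 y) //= addn_gt0 Wy. Qed.

Lemma walks_gt0_layer j v x :
  0 < walks j v x -> exists2 i, i <= j & x \in layer i v.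
Proof.
move=> Wx; have exW : exists i, 0 < walks i v x by exists j.
exists (ex_minn exW); case: ex_minnP => i Wi mini; first exact: mini.
by apply/layerP.
Qed.

Lemma layer_parent j v x :
  x \in layer j.+1 v -> exists2 y, y \in layer j v & e y x.
Proof.
case/layerP=> /= + minx; rewrite lt0n sum_nat_eq0 negb_forall => /existsP[y].
rewrite negb_imply -lt0n => /andP[eyx Wy]; exists y => //.
apply/layerP; split=> // i Wi.
by have := minx _ (walksS_gt0 eyx Wi).
Qed.

Lemma layer_neighbour j v y x : y \in layer j v -> e y x ->
  [\/ x \in layer j.+1 v, x \in layer j v | x \in layer j.-1 v /\ 0 < j].
Proof.
case/layerP=> Wy miny eyx.
have [i le_ij xi] := walks_gt0_layer (walksS_gt0 eyx Wy).
have exy : e x y by rewrite e_sym.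
have le_ji : j <= i.+1.
  by apply: miny; apply: (walksS_gt0 exy); case/layerP: xi.
have [iE|[iE|[iE j0]]] : i = j.+1 \/ i = j \/ i = j.-1 /\ 0 < j by lia.
- by apply: Or31; rewrite -iE.
- by apply: Or32; rewrite -iE.
- by apply: Or33; rewrite -iE.
Qed.

(** Follow parents from [x] and from [z] until they meet, at the latest in [v]. Both branches
    descend the same number [d <= i] of steps, so there are [2 d - 1] interior vertices, all in
    lower layers. *)
Lemma layer_path i v x z : x \in layer i v -> z \in layer i v -> x != z ->
  exists p : seq T, [/\ path e x (rcons p z), uniq (x :: rcons p z),
    odd (size p), size p < i.*2
    & forall y, y \in p -> exists2 j, j < i & y \in layer j v].
Proof.
elim: i x z => [|i IH] x z.
  by rewrite !mem_layer0 => /eqP-> /eqP->; rewrite eqxx.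
move=> xi zi neq_xz.
have [x' x'i ex'x] := layer_parent xi; have [z' z'i ez'z] := layer_parent zi.
have Nlow y j : y \in layer j v -> j <= i -> (y != x) && (y != z).
  move=> yj leji; apply/andP.
  by split; apply/eqP => yE; rewrite yE in yj;
    [have := layer_uniq yj xi|have := layer_uniq yj zi]; lia.
have [x'z'|neq'] := eqVneq x' z'.
  exists [:: x'] => /=; split=> //; rewrite ?andbT.
  - by rewrite e_sym ex'x x'z' ez'z.
  - have /andP[xx' x'z] := Nlow _ _ x'i (leqnn i).
    by rewrite !inE negb_or neq_xz x'z eq_sym xx'.
  - by move=> y; rewrite inE => /eqP->; exists i.
have [p [pp up op sp lp]] := IH _ _ x'i z'i neq'.
exists (x' :: rcons p z'); split.
- by rewrite /= rcons_path last_rcons pp ez'z e_sym ex'x.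
- rewrite -rcons_cons -rcons_cons rcons_uniq.
  have Nq y : y \in x' :: rcons p z' -> (y != x) && (y != z).
    rewrite inE mem_rcons inE => /or3P[/eqP->|/eqP->|/lp[j ltji yj]].
    - exact: Nlow x'i _.
    - exact: Nlow z'i _.
    - exact: Nlow yj (ltnW ltji).
  rewrite cons_uniq up andbT; apply/andP; split.
    rewrite in_cons negb_or eq_sym neq_xz /=; apply/negP => /Nq.
    by rewrite eqxx andbF.
  by apply/negP => /Nq; rewrite eqxx.
- by rewrite /= size_rcons /= negbK.
- by rewrite /= size_rcons doubleS !ltnS.
- move=> y; rewrite inE mem_rcons inE => /or3P[/eqP->|/eqP->|/lp[j ltji yj]].
  + by exists i.
  + by exists i.
  + by exists j => //; apply: ltnW.
Qed.

(** * Local structure without short even cycles *)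

Section EvenCycleFree.
Variable k : nat.
Hypothesis e_irr : irreflexive e.
Hypothesis e_free : even_cycle_free k.

(* A vertex [w] adjacent to both ends of the path of [layer_path] closes it to
   an even cycle. *)
Lemma layer_neighbour_uniq i j v w x z : i < k -> i <= j -> w \in layer j v ->
  x \in layer i v -> z \in layer i v -> e w x -> e w z -> x = z.
Proof.
move=> ltik leij wj xi zi ewx ewz; apply/eqP/negPn/negP => neq_xz.
have [p [pp up op sp lp]] := layer_path xi zi neq_xz.
apply: (e_free (c := w :: x :: rcons p z)).
- apply/andP; split.
    by rewrite /= rcons_path last_rcons ewx pp e_sym ewz.
  rewrite cons_uniq up andbT in_cons mem_rcons in_cons !negb_or.
  apply/and3P; split.
  + by apply: contraTneq ewx => <-; rewrite e_irr.
  + by apply: contraTneq ewz => <-; rewrite e_irr.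
  + by apply/negP => /lp[l ltli /(layer_uniq wj)]; lia.
(* The cycle has [size p + 3] vertices, an even number between [4] and [2 i + 2 <= 2 k]. *)
- by rewrite /= size_rcons /= negbK negbK.
- by rewrite /= size_rcons; lia.
Qed.

Lemma card_neighbours_layer i j v w : i < k -> i <= j -> w \in layer j v ->
  #|neighbours (layer i v) w| <= 1.
Proof.
move=> ltik leij wj; apply/card_le1_eqP => x z.
rewrite !in_neighbours => /andP[xi ewx] /andP[zi ewz].
exact: (layer_neighbour_uniq ltik leij wj).
Qed.

(** At most one neighbour lies in the same layer and one in the previous layer. Layer 0 is [v]
    alone, without a loop, so nothing is lost there. *)
Lemma degree_layer_le j v y : j < k -> y \in layer j v ->
  degree y <= #|neighbours (layer j.+1 v) y| + (if j is 0 then 0 else 2).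
Proof.
move=> ltjk yj; rewrite /degree.
case: j ltjk yj => [|j] ltjk yj.
  rewrite addn0; apply/subset_leq_card/subsetP => x.
  rewrite in_neighbours inE => eyx.
  rewrite eyx andbT; case: (layer_neighbour yj eyx) => [|x0|[]] //.
  move: x0 yj eyx; rewrite !mem_layer0 => /eqP-> /eqP->.
  by rewrite e_irr.
have le1 := card_neighbours_layer ltjk (leqnn _) yj.
have le2 := card_neighbours_layer (ltnW ltjk) (leqnSn j) yj.
apply: (@leq_trans #|neighbours (layer j.+2 v) y :|:
   (neighbours (layer j.+1 v) y :|: neighbours (layer j v) y)|).
  apply/subset_leq_card/subsetP => x; rewrite inE => eyx.
  rewrite !in_setU !in_neighbours eyx !andbT.
  by case: (layer_neighbour yj eyx) => [->|->|[-> _]]; rewrite ?orbT.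
apply: (leq_trans (leq_card_setU _ _)); rewrite leq_add2l.
apply: (leq_trans (leq_card_setU _ _)); exact: (leq_add le1 le2).
Qed.

(** Edges between layers [j] and [j.+1] are counted from both sides: a vertex of the farther layer
    has at most one neighbour in the nearer one. *)
Lemma sum_degree_layer_le j v : j < k ->
  \sum_(y in layer j v) degree y
    <= #|layer j.+1 v| + (if j is 0 then 0 else 2) * #|layer j v|.
Proof.
move=> ltjk.
have le_deg y (yj : y \in layer j v) := degree_layer_le ltjk yj.
apply: leq_trans (leq_sum _ le_deg) _.
rewrite big_split /= sum_nat_const mulnC leq_add2r.
under eq_bigr do rewrite card_neighbours.
rewrite exchange_big /= -sum1_card; apply: leq_sum => x xj.
apply: leq_trans (card_neighbours_layer ltjk (leqnSn j) xj).
by rewrite card_neighbours; apply: leq_sum => y _; rewrite e_sym.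
Qed.

End EvenCycleFree.

(** * Recursions for numbers of walks *)

Lemma sum_neighbours (F : T -> nat) :
  \sum_x \sum_(y | e y x) F y = \sum_y degree y * F y.
Proof.
rewrite (exchange_big_dep predT) //=; apply: eq_bigr => y _.
by rewrite sum_nat_cond_const.
Qed.

Lemma walks_fromS j v : walks_from j.+1 v = \sum_x degree x * walks j v x.
Proof. exact: sum_neighbours. Qed.

Lemma card_layer_le_walks_from j v : #|layer j v| <= walks_from j v.
Proof.
rewrite -sum1_card big_mkcond; apply: leq_sum => x _.
by case: ifP => // /layerP[].
Qed.

(** [walks] recurses on the last step; the entropy induction needs the first step split off. *)
Lemma walks_firstS j v x : walks j.+1 v x = \sum_(u | e v u) walks j u x.
Proof.
elim: j x => [|j IH] x.
  rewrite /= big_mkcond (bigD1 v) //= big1 => [|y /negPf vy]; last first.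
    by rewrite eq_sym vy; case: ifP.
  rewrite [RHS]big_mkcond (bigD1 x) //= big1 => [|y /negPf yx]; last first.
    by rewrite yx; case: ifP.
  by rewrite !eqxx.
transitivity (\sum_(y | e y x) \sum_(u | e v u) walks j u y).
  by apply: eq_bigr => y _; apply: IH.
exact: exchange_big.
Qed.

Lemma walks_from_firstS j v :
  walks_from j.+1 v = \sum_(u | e v u) walks_from j u.
Proof. by rewrite exchange_big; apply: eq_bigr => x _; apply: walks_firstS. Qed.

Lemma walks_from0 v : walks_from 0 v = 1.
Proof.
rewrite /walks_from (bigD1 v) //= eqxx big1 // => x /negPf.
by rewrite eq_sym => ->.
Qed.

End Layers.

(** * Upper bounds from the layers *)

Section WalkBounds.
Variables (R : realDomainType) (T : finType) (e : rel T) (k : nat).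
Hypotheses (e_sym : symmetric e) (e_irr : irreflexive e).
Hypothesis e_free : even_cycle_free e k.

(** A vertex has at most 2 neighbours outside the next layer, which leaves a growth factor [rho];
    the first step loses none and contributes the full degree of [v]. *)
Lemma layer_growth (rho : R) j v :
  0 <= rho -> (forall y, rho + 2 <= (degree e y)%:R) -> (j < k)%N ->
  (degree e v)%:R * rho ^+ j <= #|layer e j.+1 v|%:R.
Proof.
move=> rho_ge0 rho_le; elim: j => [|j IH] ltjk.
  have := sum_degree_layer_le e_sym e_irr e_free v ltjk.
  rewrite mul0n addn0 (big_pred1 v) => [le|x]; last by rewrite mem_layer0.
  by rewrite expr0 mulr1 ler_nat.
have := sum_degree_layer_le e_sym e_irr e_free v ltjk.
rewrite -(ler_nat R) natrD natrM natr_sum => le.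
rewrite exprSr mulrA; apply: le_trans (ler_wpM2r rho_ge0 (IH (ltnW ltjk))) _.
rewrite -(lerD2r (2 * #|layer e j.+1 v|%:R)); apply: le_trans le.
apply: le_trans (ler_sum _ (fun y _ => rho_le y)).
by rewrite sumr_const -[(rho + 2) *+ _]mulr_natl mulrDr [2 * _]mulrC.
Qed.

Lemma walks_from_le_exp (Delta : R) j v :
  (forall y, (degree e y)%:R <= Delta) -> (walks_from e j v)%:R <= Delta ^+ j.
Proof.
move=> le_Delta; have Delta_ge0 := le_trans (ler0n _ _) (le_Delta v).
elim: j => [|j IH]; first by rewrite walks_from0.
rewrite walks_fromS natr_sum exprS.
apply: le_trans (ler_wpM2l Delta_ge0 IH).
rewrite natr_sum mulr_sumr; apply: ler_sum => x _.
by rewrite natrM ler_wpM2r.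
Qed.

(* A non-geodesic walk from [v] leaves the layers at one of its last [j.-1]
   steps, with at most two choices for the next vertex. *)
Lemma walks_from_le (Delta : R) j v :
  (forall y, (degree e y)%:R <= Delta) -> (j <= k)%N ->
  (walks_from e j v)%:R
    <= #|layer e j v|%:R + 2 * j.-1%:R * Delta ^+ j.-1.
Proof.
move=> le_Delta; have Delta_ge0 := le_trans (ler0n _ _) (le_Delta v).
elim: j => [|j IH] ltjk.
  rewrite walks_from0 mulr0 mul0r addr0 ler_nat card_gt0.
  by apply/set0Pn; exists v; rewrite mem_layer0.
have {}IH := IH (ltnW ltjk).
have := sum_degree_layer_le e_sym e_irr e_free v ltjk.
rewrite -(ler_nat R) natrD natrM natr_sum => le_layer.
(* One walk to each vertex [y] of the layer has [degree e y] continuations; every other walk has at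
   most [Delta]. *)
have step : (walks_from e j.+1 v)%:R <=
    \sum_(y in layer e j v) (degree e y)%:R
      + Delta * ((walks_from e j v)%:R - #|layer e j v|%:R).
  rewrite walks_fromS natr_sum [(walks_from e j v)%:R]natr_sum.
  rewrite -sum1_card natr_sum [X in _ - X]big_mkcond -sumrB mulr_sumr.
  rewrite [X in _ <= X + _]big_mkcond -big_split /=; apply: ler_sum => y _.
  rewrite natrM; case: ifP => [/layerP[Wy _]|_]; last first.
    by rewrite add0r subr0 ler_wpM2r.
  rewrite -lerBlDl -[X in _ - X]mulr1 -mulrBr ler_wpM2r // subr_ge0.
  by rewrite ler1n.
apply: le_trans step _; apply: le_trans (lerD le_layer (lexx _)) _.
rewrite -addrA lerD2l /=.
case: j => [|j] in IH le_layer ltjk *.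
  rewrite mul0r add0r mulr0 mul0r.
  by apply: mulr_ge0_le0 => //; move: IH; rewrite /= mulr0 mul0r addr0 subr_le0.
have le_layerX : #|layer e j.+1 v|%:R <= Delta ^+ j.+1.
  apply: le_trans (walks_from_le_exp j.+1 v le_Delta).
  by rewrite ler_nat card_layer_le_walks_from.
have {}IH : (walks_from e j.+1 v)%:R - #|layer e j.+1 v|%:R
              <= 2 * j%:R * Delta ^+ j by rewrite lerBlDl.
apply: le_trans (lerD (ler_wpM2l _ le_layerX) (ler_wpM2l Delta_ge0 IH)) _ => //.
by rewrite -natr1 exprS le_eqVlt; apply/orP; left; apply/eqP; ring.
Qed.

End WalkBounds.

(** * Lower bound on walks by entropy *)

Section WalkCount.
Variables (R : realType) (T : finType) (e : rel T).
Hypothesis e_sym : symmetric e.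

Lemma jensen_ln (I : finType) (P : pred I) (p y : I -> R) :
  (forall i, P i -> 0 <= p i) -> (forall i, P i -> 0 < y i) ->
  0 < \sum_(i | P i) p i ->
  \sum_(i | P i) p i * ln (y i) <=
  (\sum_(i | P i) p i) * ln ((\sum_(i | P i) p i * y i) / \sum_(i | P i) p i).
Proof.
move=> p_ge0 y_gt0; set Q := \sum_(i | P i) p i => Q_gt0.
set S := \sum_(i | P i) p i * y i.
have py_ge0 i : P i -> 0 <= p i * y i.
  by move=> Pi; apply: mulr_ge0; [apply: p_ge0|apply/ltW/y_gt0].
have S_gt0 : 0 < S.
  rewrite lt_def sumr_ge0 // andbT; apply: contraTneq Q_gt0 => S0.
  rewrite -leNgt /Q big1 // => i Pi; apply/eqP.
  have /eqP := psumr_eq0P py_ge0 S0 Pi.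
  by rewrite mulf_eq0 (gt_eqF (y_gt0 i Pi)) orbF.
have a_gt0 : 0 < S / Q by apply: divr_gt0.
(* By concavity [ln] lies below its tangent at the weighted mean [S / Q]; the linear terms cancel in
   the weighted sum. *)
have tangent i : P i -> ln (y i) <= ln (S / Q) + (y i / (S / Q) - 1).
  move=> Pi; have yi := y_gt0 i Pi.
  rewrite -lerBlDl -ln_div ?posrE //.
  rewrite -{1}[_ / (S / Q)](subrK 1) [_ + 1]addrC le_ln1Dx //.
  by rewrite ltrBrDr addNr divr_gt0.
apply: le_trans (ler_sum _ (fun i Pi =>
  ler_wpM2l (p_ge0 i Pi) (tangent i Pi))) _.
under eq_bigr do rewrite mulrDr mulrBr mulr1 mulrA.
rewrite big_split sumrB /= -!mulr_suml -/Q -/S.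
have -> : S / (S / Q) = Q by field; rewrite !gt_eqF.
by rewrite subrr addr0.
Qed.

Lemma sum_neighbours_real (F : T -> R) :
  \sum_x \sum_(y | e x y) F y = \sum_y (degree e y)%:R * F y.
Proof.
rewrite (exchange_big_dep predT) //=; apply: eq_bigr => y _.
rewrite sumr_const mulr_natl; congr (_ *+ _).
by apply: eq_card => x; rewrite !inE e_sym.
Qed.

Let M : R := \sum_x (degree e x)%:R.

Hypothesis degree_gt0 : forall x, (0 < degree e x)%N.
Hypothesis T_gt0 : (0 < #|T|)%N.

Lemma walks_from_gt0 j v : (0 < walks_from e j v)%N.
Proof.
elim: j v => [|j IH] v; first by rewrite walks_from0.
rewrite walks_from_firstS; have /card_gt0P[u] := degree_gt0 v.
by rewrite inE => evu; rewrite (bigD1 u) //= addn_gt0 IH.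
Qed.

Lemma sum_degree_gt0 : 0 < M.
Proof.
rewrite /M -natr_sum ltr0n; have /card_gt0P[x _] := T_gt0.
by rewrite (bigD1 x) //= addn_gt0 degree_gt0.
Qed.

Lemma sum_degree_ln :
  M * ln (M / #|T|%:R) <= \sum_x (degree e x)%:R * ln (degree e x)%:R.
Proof.
have d_gt0 x : 0 < (degree e x)%:R :> R by rewrite ltr0n.
have T0 : 0 < #|T|%:R :> R by rewrite ltr0n.
(* Values inverse to the weights make the weighted sum equal to [#|T|]; negating the logarithms
   reverses the inequality. *)
have := @jensen_ln T predT (fun x => (degree e x)%:R)
  (fun x => (degree e x)%:R^-1).
rewrite -/M => /(_ (fun _ _ => ler0n _ _)) /(_ _ sum_degree_gt0).
have -> : \sum_x (degree e x)%:R / (degree e x)%:R = #|T|%:R :> R.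
  by under eq_bigr do rewrite divff ?gt_eqF //; rewrite sumr_const.
have -> : #|T|%:R / M = (M / #|T|%:R)^-1 by rewrite invf_div.
rewrite lnV ?posrE ?divr_gt0 ?sum_degree_gt0 // mulrN.
under eq_bigr do rewrite lnV ?posrE // mulrN.
by rewrite sumrN lerN2; apply=> x _; rewrite invr_gt0.
Qed.

(* The uniform random walk is stationary for the weights [degree], so each step
   contributes at least the entropy [sum_degree_ln]. *)
Lemma sum_degree_ln_walks_from j :
  j%:R * (M * ln (M / #|T|%:R))
    <= \sum_x (degree e x)%:R * ln (walks_from e j x)%:R.
Proof.
have d_gt0 x : 0 < (degree e x)%:R :> R by rewrite ltr0n.
have w_gt0 i x : 0 < (walks_from e i x)%:R :> R by rewrite ltr0n walks_from_gt0.
elim: j => [|j IH].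
  by rewrite mul0r big1 // => x _; rewrite walks_from0 ln1 mulr0.
rewrite -natr1 mulrDl mul1r addrC.
apply: le_trans (lerD sum_degree_ln IH) _.
rewrite -(sum_neighbours_real (fun u => ln (walks_from e j u)%:R)).
rewrite -big_split /=; apply: ler_sum => x _.
(* With unit weights on the neighbours of [x] the values add up to [walks_from e j.+1 x]; dividing
   by the total weight yields the term [ln (degree e x)]. *)
have := @jensen_ln T (e x) (fun=> 1) (fun u => (walks_from e j u)%:R).
have -> : \sum_(u | e x u) 1 = (degree e x)%:R :> R.
  by rewrite sumr_const; congr (_ *+ _); apply: eq_card => u; rewrite inE.
have mul1 (G : T -> R) : \sum_(u | e x u) 1 * G u = \sum_(u | e x u) G u.
  by apply: eq_bigr => u _; rewrite mul1r.
rewrite (mul1 (fun u => ln _)) (mul1 (fun u => (walks_from e j u)%:R)).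
rewrite -natr_sum -walks_from_firstS.
move=> /(_ (fun _ _ => ler01)) /(_ (fun _ _ => w_gt0 _ _)) /(_ (d_gt0 x)).
by rewrite ln_div ?posrE // mulrBr lerBrDl.
Qed.

(** This is the Blakley-Roy inequality, as [M / #|T|] is the average degree. It follows by Jensen
    with weights [degree], applied to the walks after the first step. *)
Lemma sum_walks_from_ge j :
  M * (M / #|T|%:R) ^+ j <= \sum_v (walks_from e j.+1 v)%:R.
Proof.
have M0 := sum_degree_gt0; have T0 : 0 < #|T|%:R :> R by rewrite ltr0n.
have w_gt0 i x : 0 < (walks_from e i x)%:R :> R by rewrite ltr0n walks_from_gt0.
have -> : \sum_v (walks_from e j.+1 v)%:R
            = \sum_u (degree e u)%:R * (walks_from e j u)%:R :> R.
  rewrite -sum_neighbours_real; apply: eq_bigr => v _.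
  by rewrite walks_from_firstS natr_sum.
set S := \sum_u _; have S0 : 0 < S.
  have /card_gt0P[x _] := T_gt0; rewrite /S (bigD1 x) //=.
  apply: ltr_pwDl; first by rewrite mulr_gt0 // ltr0n.
  by apply: sumr_ge0 => u _; rewrite mulr_ge0.
rewrite mulrC -ler_pdivlMr // -ler_ln ?posrE ?exprn_gt0 ?divr_gt0 //.
rewrite lnXn ?divr_gt0 // -[ln _ *+ _]mulr_natl -(ler_pM2l M0) mulrCA.
apply: le_trans (sum_degree_ln_walks_from j) _.
exact: jensen_ln.
Qed.

End WalkCount.

(** * Comparison of the two walk counts *)

Lemma exprD_ge_linear (R : realDomainType) (r x : R) j : 0 <= r -> 0 <= x ->
  r ^+ j.+1 + j.+1%:R * x * r ^+ j <= (r + x) ^+ j.+1.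
Proof.
move=> r0 x0; elim: j => [|j IH]; first by rewrite expr0 mulr1 mul1r !expr1.
rewrite [leRHS]exprS; apply: le_trans (ler_wpM2l (addr_ge0 r0 x0) IH).
have : 0 <= j.+1%:R * x * x * r ^+ j by rewrite !mulr_ge0 // exprn_ge0.
rewrite -[j.+2%:R]natr1 !exprS => h.
rewrite -subr_ge0; apply: le_trans h _; rewrite le_eqVlt; apply/orP; left.
by apply/eqP; ring.
Qed.

Lemma even_cycle_free_sparse (R : realType) (T : finType) (e : rel T) (m : nat)
    (r C : R) :
  symmetric e -> irreflexive e -> even_cycle_free e m.+1 -> (0 < #|T|)%N ->
  0 < r -> #|T|%:R <= r ^+ m.+1 -> 2 ^+ (m ^ 2) < C -> 2 <= C ->
  (forall x, r / 2 + C <= (degree e x)%:R) ->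
  \sum_x (degree e x)%:R < (r + 2 * C) * #|T|%:R.
Proof.
move=> e_sym e_irr e_free T0 r0 leTr ltC C2 min_deg.
rewrite ltNge; apply/negP => le_M; set M := \sum_x _ in le_M.
have T0R : 0 < #|T|%:R :> R by rewrite ltr0n.
have C0 : 0 < C by apply: lt_le_trans C2.
have r2 : 0 < r / 2 by apply: divr_gt0.
have card_layer v : #|layer e m.+1 v|%:R <= r ^+ m.+1.
  by apply: le_trans leTr; rewrite ler_nat max_card.
(* Layer [m.+1] has at least [degree e v * (r / 2) ^+ m] and at most [r ^+ m.+1] vertices. Since
   [2 <= C], [layer_growth] applies with [rho = r / 2]. *)
have max_deg v : (degree e v)%:R <= 2 ^+ m * r.
  rewrite -(ler_pM2r (exprn_gt0 m r2)).
  have rE : 2 ^+ m * r * (r / 2) ^+ m = r ^+ m.+1.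
    by rewrite mulrAC -exprMn mulrCA divff ?pnatr_eq0 // mulr1 exprSr.
  rewrite rE; apply: le_trans (card_layer v).
  apply: (layer_growth e_sym e_irr e_free v (ltW r2)) => // y.
  by apply: le_trans (min_deg y); rewrite lerD2l.
have walks_le v : (walks_from e m.+1 v)%:R
    <= r ^+ m.+1 + 2 * m%:R * (2 ^+ m * r) ^+ m.
  apply: le_trans (walks_from_le e_sym e_irr e_free v max_deg (leqnn _)) _.
  by rewrite lerD2r.
have deg_gt0 x : (0 < degree e x)%N.
  by rewrite -(ltr0n R); apply: lt_le_trans (min_deg x); rewrite addr_gt0.
have := sum_walks_from_ge R e_sym deg_gt0 T0 m; rewrite -/M.
move=> /le_trans/(_ (ler_sum _ (fun v _ => walks_le v))).
rewrite sumr_const -[leRHS]mulr_natr => le_walks.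
have /le_trans/(_ le_walks) :
    (r + 2 * C) ^+ m.+1 * #|T|%:R <= M * (M / #|T|%:R) ^+ m.
  have le_d : r + 2 * C <= M / #|T|%:R by rewrite ler_pdivlMr.
  have d0 : 0 <= r + 2 * C by rewrite addr_ge0 ?mulr_ge0 // ltW.
  rewrite exprS mulrAC; apply: ler_pM => //.
  - by rewrite mulr_ge0.
  - exact: exprn_ge0.
  - by apply: lerXn2r => //; rewrite nnegrE // (le_trans d0).
rewrite ler_pM2r //.
have C20 : 0 <= 2 * C by rewrite mulr_ge0 // ltW.
(* Of the binomial expansion two terms suffice: [r ^+ m.+1] cancels, and what remains is
   [m.+1 * (2 C) <= 2 m * 2 ^+ (m ^ 2)], against [2 ^+ (m ^ 2) < C]. *)
move=> /(le_trans (exprD_ge_linear m (ltW r0) C20)).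
rewrite lerD2l exprMn [_ * (_ * r ^+ m)]mulrA ler_pM2r ?exprn_gt0 //.
rewrite -exprM mulnn.
apply/negP; rewrite -ltNge.
have m0 : 0 <= m%:R :> R by [].
rewrite -natr1.
by have := ler_wpM2l m0 (ltW ltC); lra.
Qed.

(** * Passage to an induced subgraph *)

(* Take [S] maximising the degree sum minus [2 c #|S|]: removing a vertex of
   degree below [c] would increase it. *)
Lemma dense_induced_subgraph (R : realDomainType) (T : finType) (e : rel T)
    (c : R) :
  symmetric e -> irreflexive e ->
  2 * c * #|T|%:R < \sum_x (degree e x)%:R ->
  exists S : {set T},
    2 * c * #|S|%:R < \sum_(x in S) #|neighbours e S x|%:R
    /\ forall x, x \in S -> c <= #|neighbours e S x|%:R.
Proof.
move=> e_sym e_irr dense.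
pose D (S : {set T}) := (\sum_(x in S) #|neighbours e S x|)%N.
(* Deleting [v] loses its degree twice: in its own term and spread over its neighbours. *)
have DD1 (S : {set T}) v :
    v \in S -> D S = (D (S :\ v) + 2 * #|neighbours e S v|)%N.
  move=> vS; rewrite /D.
  have N1 x : #|neighbours e S x| = (e x v + #|neighbours e (S :\ v) x|)%N.
    by rewrite !card_neighbours (big_setD1 v).
  rewrite (big_setD1 v) //= (eq_bigr _ (fun x _ => N1 x)) big_split /=.
  have -> : (\sum_(x in S :\ v) e x v = #|neighbours e S v|)%N.
    rewrite N1 e_irr add0n card_neighbours; apply: eq_bigr => x _.
    by rewrite e_sym.
  lia.
pose F (S : {set T}) : R := (D S)%:R - 2 * c * #|S|%:R.
case: (@arg_maxP _ _ _ [set: T] predT F isT) => S _ maxS.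
exists S; split.
  rewrite -natr_sum -subr_gt0; apply: lt_le_trans (maxS [set: T] isT).
  rewrite /F cardsT subr_gt0; apply: lt_le_trans dense _.
  rewrite natr_sum big_mkcond [leRHS]big_mkcond /=.
  apply: ler_sum => x _; rewrite inE ler_nat.
  by apply/subset_leq_card/subsetP => y; rewrite !inE.
move=> x xS; have := maxS (S :\ x) isT.
rewrite /F (DD1 _ _ xS) [#|S|](cardsD1 x) xS natrD.
rewrite [(2 * _)%N%:R]natrM [(_ + #|_|)%N%:R]natrD /=; lra.
Qed.

Section Induced.
Variables (T : finType) (e : rel T) (S : {set T}).

(** On the subtype, the lemmas about a whole vertex type apply. *)
Definition induced : rel {x : T | x \in S} := relpre val e.

Lemma degree_induced u : degree induced u = #|neighbours e S (val u)|.
Proof.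
rewrite /degree -(card_imset _ val_inj); apply: eq_card => y.
rewrite in_neighbours; apply/imsetP/andP => [[w + ->]|[yS euy]].
  by rewrite inE => euw; rewrite (valP w).
by exists (Sub y yS); rewrite ?inE.
Qed.

Lemma sum_induced (V : nmodType) (F : T -> V) :
  \sum_(x in S) F x = \sum_(u : {x : T | x \in S}) F (val u).
Proof.
rewrite (@reindex_omap _ _ _ _ {x : T | x \in S} val insub) => [|x xS];
  last by rewrite insubT.
by apply: eq_bigl => u; rewrite (valP u) valK eqxx.
Qed.

Lemma induced_even_cycle_free k :
  even_cycle_free e k -> even_cycle_free induced k.
Proof.
move=> e_free c /andP[cyc_c uniq_c] odd_c size_c.
apply: (e_free (map val c)); rewrite ?size_map //.
by apply/andP; rewrite map_inj_uniq ?cycle_map //; apply: val_inj.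
Qed.

End Induced.

(** * Edge sets and the final bound *)

Lemma sum_degree_adjacent (T : finType) (E : {set {set T}}) :
  simple_graph E -> (2 * #|E| <= \sum_x degree (adjacent E) x)%N.
Proof.
move=> /forall_inP card2.
have -> : (2 * #|E| = \sum_(f in E) \sum_(x in f) 1)%N.
  rewrite mulnC -sum_nat_const; apply: eq_bigr => f fE.
  by rewrite sum1_card; apply/esym/eqP/card2.
rewrite (exchange_big_dep predT) //=; apply: leq_sum => x _.
rewrite sum1dep_card.
(* Every edge at [x] is the image of a neighbour [y]. *)
apply: leq_trans (leq_imset_card (fun y => [set x; y]) _).
apply/subset_leq_card/subsetP => f; rewrite inE => /andP[fE xf].
have /cards2P[a [b [_ fab]]] := card2 f fE.
have [y fxy] : exists y, f = [set x; y].
  move: xf; rewrite fab !inE => /orP[]/eqP->; first by exists b.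
  by exists a; rewrite setUC.
by apply/imsetP; exists y; rewrite // inE /adjacent /= -fxy.
Qed.

Lemma adjacent_even_cycle_free (T : finType) (E : {set {set T}}) k :
  (forall l, l \in even_lengths k -> ~~ contains_cycle E l) ->
  even_cycle_free (adjacent E) k.
Proof.
move=> noC c cyc_c even_c size_c.
have /noC/existsP[] : size c \in even_lengths k.
  by rewrite mem_even_lengths even_c.
by exists (in_tuple c).
Qed.

Theorem theorem1 (R : realType) (k : nat) (hk : (2 <= k)%N)
    (n : nat) (hn : (0 < n)%N) :
  (ex_cycles n (even_lengths k))%:R
    <= 2^-1 * n%:R `^ (1 + k%:R^-1) + 2 ^+ (k ^ 2)%N * n%:R :> R.
Proof.
case: k hk => [//|m] hk; set k := m.+1.
set r : R := n%:R `^ k%:R^-1; set C : R := 2 ^+ (k ^ 2).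
have n0 : 0 < n%:R :> R by rewrite ltr0n.
have k0 : k%:R != 0 :> R by rewrite pnatr_eq0.
have r0 : 0 < r by apply: powR_gt0.
have rk : r ^+ k = n%:R.
  by rewrite -powR_mulrn ?(ltW r0) // -powRrM mulVf // powRr1 // ltW.
have -> : n%:R `^ (1 + k%:R^-1) = n%:R * r.
  by rewrite powRD ?powRr1 ?(ltW n0) // (gt_eqF n0) implybT.
have bound_ge0 : 0 <= 2^-1 * (n%:R * r) + C * n%:R.
  by rewrite addr_ge0 // !mulr_ge0 ?exprn_ge0 ?invr_ge0 // ltW.
(* [ex_cycles_leP] takes a natural bound, hence the truncation. *)
rewrite -truncn_ge_nat //; apply/ex_cycles_leP => E simpleE freeE.
rewrite truncn_ge_nat // leNgt; apply/negP => dense.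
have a_sym : symmetric (adjacent E) by move=> x y; rewrite /adjacent /= setUC.
have a_irr : irreflexive (adjacent E).
  move=> x; apply/negP => /= /(forall_inP simpleE).
  by rewrite setUid cards1.
have a_free := adjacent_even_cycle_free freeE.
(* The constant [c] is the claimed bound divided by [n]. *)
have [|S [S_dense S_min]] :=
  dense_induced_subgraph (c := r / 2 + C) a_sym a_irr.
  have := sum_degree_adjacent simpleE.
  rewrite -(ler_nat R) natrM natr_sum card_ord => /(lt_le_trans _); apply.
  lra.
have cardS : #|{: {x | x \in S}}| = #|S|.
  by rewrite card_sig; apply: eq_card => x; rewrite inE.
have S0 : (0 < #|S|)%N.
  rewrite lt0n; apply: contraTneq S_dense => /eqP.
  by rewrite cards_eq0 => /eqP->; rewrite big_set0 cards0 mulr0 ltxx.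
have := S_dense; apply/negP; rewrite -leNgt.
have -> : 2 * (r / 2 + C) = r + 2 * C by field.
rewrite (sum_induced S (fun x => #|neighbours (adjacent E) S x|%:R)) -cardS.
under eq_bigr do rewrite -degree_induced.
have gt1 : 1 < 2 :> R by rewrite ltr1n.
apply/ltW/(even_cycle_free_sparse (m := m)); rewrite ?cardS //.
- by move=> x y; apply: a_sym.
- by move=> x; apply: a_irr.
- exact: induced_even_cycle_free.
- by rewrite -/k rk ler_nat -[leqRHS]card_ord max_card.
(* Strictness comes from [m ^ 2 < k ^ 2] with [k = m.+1]. *)
- by rewrite ltr_eXn2l // ltn_exp2r.
- by rewrite -[leLHS]expr1 ler_eXn2l // expn_gt0.
- by move=> x; rewrite degree_induced; apply/S_min/valP.
Qed.
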